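(* For every $c < 4/3$ there exist speed limits $v_1,\dots,v_k>0$ and a schedule for $k$ agents with these speed limits that patrols a fence of length $c(v_1+\dots+v_k)/2$ with idle time $1$.
   Context: A fence of length $L$ is the interval $[0,L]$. A schedule for $k$ agents with speed limits $v_1,\dots,v_k$ is a $k$-tuple $(a_1,\dots,a_k)$ of functions $a_i\colon\mathbb{R}\to\mathbb{R}$ with $|a_i(s)-a_i(t)|\le v_i|s-t|$ for all $s,t\in\mathbb{R}$. It patrols the fence $[0,L]$ with idle time $1$ if for every $t\in\mathbb{R}$ and every $x\in[0,L]$ there are an agent $i$ and a time $t'\in[t,t+1)$ with $a_i(t')=x$. *)

(* Defs.v *)
From mathcomp Require Import all_boot all_order all_algebra.
From mathcomp Require Import reals.
Set Implicit Arguments.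
Unset Strict Implicit.
Unset Printing Implicit Defensive.
Import Order.TTheory GRing.Theory Num.Theory.
Local Open Scope ring_scope.

Definition is_schedule (R : realType) (k : nat) (v : 'I_k -> R)
    (a : 'I_k -> R -> R) : Prop :=
  forall (i : 'I_k) (s t : R), `|a i s - a i t| <= v i * `|s - t|.

(* If L < 0 the interval `[0, L] is empty, so the condition holds vacuously. *)
Definition patrols (R : realType) (k : nat) (a : 'I_k -> R -> R)
    (L T : R) : Prop :=
  forall t x : R, x \in `[0, L] ->
    exists (i : 'I_k) (t' : R), (t' \in `[t, t + T[) /\ a i t' = x.

(* Main.v *)
(** A swarm of agents of speed 1 at unit distance, all moving in the same
    direction, visits each point once per unit time with no waste.  When the
    whole swarm reverses, a point that was about to be visited waits up to 2
    time units in all, but a single visit at the moment of the reversal repairs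
    this.  So one very fast agent sweeps the whole fence repeatedly, and every
    swarm agent reverses exactly when the fast agent meets it on a rightward
    sweep.  In the skewed time [u = t - x / m], where [m] is the fast speed, the
    sweeps become instantaneous and all reversals simultaneous; between two of
    them the swarm moves linearly.  A fence of length [m q] needs
    [q (m + 3) + 1] agents of speed 1 besides the fast one, so [m = 13], [q = 4]
    already yields ratio exactly 4/3: length 52, total speed 78. *)

Require Import Defs.
From mathcomp Require Import all_boot all_order all_algebra.
From mathcomp Require Import reals.
From mathcomp Require Import boolp classical_sets zify ring lra.
Set Implicit Arguments.
Unset Strict Implicit.
Unset Printing Implicit Defensive.
Import Order.TTheory GRing.Theory Num.Theory.
Local Open Scope ring_scope.

(** McShane extension: the supremum of the downward cones of slope [v] with apexes at the prescribed
    points [(F i, X i)]. The bound [M] keeps it finite. Paths can thus be given just by the visits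
    that matter. *)
Lemma lipschitz_extension (R : realType) (I : Type) (D : set I) (F X : I -> R)
    (v M : R) (i0 : I) :
  0 <= v -> D i0 -> (forall i, D i -> X i <= M) ->
  (forall i j, D i -> D j -> `|X i - X j| <= v * `|F i - F j|) ->
  exists a : R -> R, (forall s t, `|a s - a t| <= v * `|s - t|) /\
    (forall i, D i -> a (F i) = X i).
Proof.
move=> v0 Di0 XM XF.
pose S t := [set X i - v * `|t - F i| | i in D]%classic.
have S0 t : (S t !=set0)%classic by exists (X i0 - v * `|t - F i0|); exists i0.
have SM t : has_ubound (S t).
  exists M => _ [i Di <-]; rewrite lerBlDr (le_trans (XM _ Di))//.
  by rewrite lerDl mulr_ge0.
have le_a t i : D i -> X i - v * `|t - F i| <= sup (S t).
  by move=> Di; apply: ub_le_sup => //; exists i.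
have half s t : sup (S s) <= sup (S t) + v * `|s - t|.
  apply: ge_sup => // _ [i Di <-].
  have := le_a t i Di; have : v * `|t - F i| <= v * (`|s - t| + `|s - F i|).
    by rewrite ler_wpM2l// (distrC s t) ler_distD.
  by rewrite mulrDr; lra.
exists (fun t => sup (S t)); split=> [s t|i Di].
  rewrite ler_norml lerBlDr [_ * _ + _]addrC half andbT.
  by have := half t s; rewrite (distrC t s); lra.
apply/le_anti/andP; split; last first.
  by have := le_a (F i) i Di; rewrite subrr normr0 mulr0 subr0.
apply: ge_sup => // _ [j Dj <-].
by have := XF j i Dj Di; rewrite (distrC (F j)) ler_norml => /andP[_]; lra.
Qed.

Lemma int_in_unit_interval (R : realType) (x : R) :
  exists n : int, x <= n%:~R < x + 1.
Proof.
exists (Num.ceil x); rewrite Num.Theory.ceil_ge/=.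
by have := Num.Theory.ceilB1_lt x; rewrite rmorphB/=; lra.
Qed.

Lemma normr_intr_ge1 (R : realType) (k : int) : k != 0 -> 1 <= `|k%:~R| :> R.
Proof. by move=> k0; rewrite -intr_norm ler1z; lia. Qed.

(** A rightward sweep takes time [q] of the period [2 * q], which leaves just enough time to return
    at speed [m]. *)
Lemma sweeping_path (R : realType) (m q : nat) : (0 < m)%N -> (0 < q)%N ->
  exists a : R -> R, (forall s t, `|a s - a t| <= m%:R * `|s - t|) /\
    (forall (k : int) x, 0 <= x <= m%:R * q%:R ->
      a (2 * q%:R * k%:~R + x / m%:R) = x).
Proof.
move=> m_gt0 q_gt0; set mR : R := m%:R; set qR : R := q%:R.
have mR_gt0 : 0 < mR by rewrite ltr0n.
have qR_gt0 : 0 < qR by rewrite ltr0n.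
pose D : set (int * R) := [set p | 0 <= p.2 <= mR * qR]%classic.
have [|[k x]/andP[]//|[k x] [l y]|a [aL aE]] := @lipschitz_extension R _ D
  (fun p => 2 * qR * p.1%:~R + p.2 / mR) snd mR (mR * qR) (0, 0) (ltW mR_gt0).
- by rewrite /D/= lexx mulr_ge0// ltW.
- rewrite /D/= => /andP[x0 xL] /andP[y0 yL].
  have {1}-> : mR = `|mR| by rewrite gtr0_norm.
  rewrite -normrM.
  have -> : mR * (2 * qR * k%:~R + x / mR - (2 * qR * l%:~R + y / mR)) =
    2 * (mR * qR) * (k - l)%:~R + (x - y).
    by rewrite rmorphB/=; field; rewrite gt_eqF.
  have [->|kl] := eqVneq k l; first by rewrite subrr mulr0 add0r.
  have kl1 := @normr_intr_ge1 R (k - l) ltac:(lia).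
  have xy : `|x - y| <= mR * qR by rewrite ler_norml; apply/andP; split; lra.
  have L0 : 0 < mR * qR by rewrite mulr_gt0.
  have := lerB_normD (2 * (mR * qR) * (k - l)%:~R) (x - y).
  rewrite normrM (gtr0_norm (_ : 0 < 2 * (mR * qR))) ?mulr_gt0//.
  by nra.
by exists a; split=> // k x xL; apply: (aE (k, x)).
Qed.

(* In the skewed time [u = t - x / m] this is a triangle wave of slope
   [+- m / (m + 1)], which amounts to true speed at most [1]. *)
Lemma zigzag_path (R : realType) (m q : nat) (i : R) :
  (0 < m)%N -> (0 < q)%N ->
  exists a : R -> R, (forall s t, `|a s - a t| <= `|s - t|) /\
    (forall (j : int) w x, `|w| <= 2 * q%:R ->
      x = m%:R / (m%:R + 1) * (i + `|w| - 2 * q%:R) ->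
      a (4 * q%:R * j%:~R + w + x / m%:R) = x).
Proof.
move=> m_gt0 q_gt0; set mR : R := m%:R; set qR : R := q%:R.
have mR_gt0 : 0 < mR by rewrite ltr0n.
have qR_gt0 : 0 < qR by rewrite ltr0n.
move sdef: (mR / (mR + 1)) => s.
have s_gt0 : 0 < s by rewrite -sdef divr_gt0// addr_gt0.
(* Leftward motion has true speed exactly 1: in one unit of skewed time the agent moves by [s] while
   true time advances by [1 - s / mR = s]. *)
have sE : s + s / mR = 1 by rewrite -sdef; field; rewrite !gt_eqF// ltr_wpDl// ltW.
pose D : set (int * R) := [set p | `|p.2| <= 2 * qR]%classic.
pose X (p : int * R) := s * (i + `|p.2| - 2 * qR).
have [|[k x]|[k x] [l y]|a [aL aE]] := @lipschitz_extension R _ D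
  (fun p => 4 * qR * p.1%:~R + p.2 + X p / mR) X 1 (s * i) (0, 0) ler01.
- by rewrite /D/= normr0 mulr_ge0// ltW.
- by rewrite /D/X/= => xq; rewrite ler_wpM2l ?(ltW s_gt0)//; lra.
- rewrite /D/= => xq yq; rewrite mul1r.
  set u := 4 * qR * (k - l)%:~R + (x - y).
  have XE : X (k, x) - X (l, y) = s * (`|x| - `|y|) by rewrite /X/=; ring.
  have -> : 4 * qR * k%:~R + x + X (k, x) / mR -
      (4 * qR * l%:~R + y + X (l, y) / mR) = u + (X (k, x) - X (l, y)) / mR.
    by rewrite /u rmorphB/=; ring.
  rewrite XE.
  (* The triangle wave is 1-Lipschitz in skewed time. For distinct periods, [4 * qR - |x| - |y|]
     bounds [|u|] from below, and [|x|], [|y|] are at most [2 * qR]. *)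
  have xyu : `|(`|x| - `|y|)| <= `|u|.
    rewrite /u; have [->|kl] := eqVneq k l.
      by rewrite subrr mulr0 add0r ler_dist_dist.
    have kl1 := @normr_intr_ge1 R (k - l) ltac:(lia).
    have := lerB_normD (4 * qR * (k - l)%:~R) (x - y).
    rewrite normrM (gtr0_norm (_ : 0 < 4 * qR)) ?mulr_gt0// => h.
    have xy := ler_normB x y.
    by rewrite ler_norml; apply/andP; split; nra.
  have := lerB_normD u (s * (`|x| - `|y|) / mR).
  rewrite mulrAC (normrM (s / mR)) (gtr0_norm (divr_gt0 s_gt0 mR_gt0)).
  rewrite (normrM s) (gtr0_norm s_gt0).
  set d := `|_ - _| in xyu *.
  have : d * (s + s / mR) = d by rewrite sE mulr1.
  rewrite mulrDr; lra.
exists a; split=> [p t|j w x wq xE]; first by rewrite -[leRHS]mul1r.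
by have := aE (j, w) wq; rewrite /X/= -xE.
Qed.

Lemma unit_speed_swarm_patrols (R : realType) (m q : nat)
    (v : 'I_(q * (m + 3) + 1).+1 -> R) :
  (0 < m)%N -> (0 < q)%N ->
  (forall i, v i = if (i < q * (m + 3) + 1)%N then 1 else m%:R) ->
  exists a : 'I_(q * (m + 3) + 1).+1 -> R -> R,
    is_schedule v a /\ patrols a (m * q)%:R 1.
Proof.
move=> m_gt0 q_gt0 vE.
have [f [fL fE]] := sweeping_path R m_gt0 q_gt0.
have [z zP] := choice (fun i : nat => zigzag_path (i%:R : R) m_gt0 q_gt0).
exists (fun i => if (i < q * (m + 3) + 1)%N then z i else f); split.
  move=> i s t; rewrite vE; case: ifP => _ //.
  by rewrite mul1r; have [+ _] := zP i; apply.
move=> t x; rewrite in_itv/= natrM => /andP[x0 xL].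
have mR_gt0 : 0 < m%:R :> R by rewrite ltr0n.
have qR_gt0 : 0 < q%:R :> R by rewrite ltr0n.
set mR : R := m%:R in xL fL fE mR_gt0 zP *.
set qR : R := q%:R in xL fE qR_gt0 zP *.
pose u0 := t - x / mR.
(* [2 * qR * k] is the first reversal at or after [u0]. If it comes before [u0 + 1], the fast agent
   makes the visit. *)
have [k /andP[k1 k2]] := int_in_unit_interval (u0 / (2 * qR)).
have Q0 : 0 < 2 * qR by rewrite mulr_gt0.
rewrite ler_pdivrMr// in k1.
rewrite -ltrBlDr ltr_pdivlMr// in k2.
have [kQ|kQ] := ltP (2 * qR * k%:~R) (u0 + 1).
  exists ord_max, (2 * qR * k%:~R + x / mR).
  rewrite /= ltnn fE ?x0//; split=> //.
  by rewrite in_itv/=; apply/andP; split; rewrite /u0 in k1 k2 kQ; lra.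
(* Position in units of the spacing [m / (m + 1)] of the swarm. *)
pose y := x * (mR + 1) / mR + 2 * qR.
have yE : x = mR / (mR + 1) * (y - 2 * qR).
  by rewrite /y; field; rewrite !gt_eqF// ltr_wpDl// ltW.
(* A visiting agent has index [y - |w|] with [|w| <= 2 * qR], so these two bounds place it among
   [0, ..., q * (m + 3)]. *)
have y_ge : 2 * qR <= y by rewrite lerDr divr_ge0// ?mulr_ge0// ?addr_ge0// ltW.
have y_le : y <= qR * (mR + 3).
  have -> : qR * (mR + 3) = (mR * qR) * (mR + 1) / mR + 2 * qR.
    by field; rewrite gt_eqF.
  by rewrite lerD2r ler_pM2r ?invr_gt0// ler_pM2r// ltr_wpDl// ltW.
suff [i [j [w [yw wq wu]]]] : exists (i j : int) (w : R),
    [/\ i%:~R + `|w| = y, `|w| <= 2 * qR & u0 <= 4 * qR * j%:~R + w < u0 + 1].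
  have i_ge0 : 0 <= i by rewrite -(ler0z R); lra.
  have [n iE] : exists n : nat, i = n by exists `|i|%N; rewrite gez0_abs.
  have n_lt : (n < q * (m + 3) + 1)%N.
    rewrite addn1 ltnS -(ler_nat R) natrM natrD -/mR -/qR.
    have : i%:~R = n%:R :> R by rewrite iE.
    by have := normr_ge0 w; lra.
  exists (widen_ord (leqnSn _) (Ordinal n_lt)), (4 * qR * j%:~R + w + x / mR).
  split; first by rewrite in_itv/=; rewrite /u0 in wu; apply/andP; split; lra.
  rewrite /= n_lt; have [_] := zP n; apply=> //.
  by rewrite {1}yE -yw iE.
(* The parity of [k] gives the direction of the swarm before that reversal: right if odd, left if
   even. Successive agents then pass [x] at skewed times one apart, so rounding up finds one in the
   window. *)
have [j [kj|kj]] : exists j : int, k = 2 * j + 1 \/ k = 2 * j.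
- by exists (k %/ 2)%Z; lia.
- have kR : k%:~R = 2 * j%:~R + 1 :> R by rewrite kj rmorphD rmorphM.
  have [n /andP[n1 n2]] := int_in_unit_interval (u0 - y).
  exists (4 * q%:Z * j - n), j, (y + n%:~R - 4 * qR * j%:~R).
  rewrite kR in k2 kQ.
  rewrite ger0_norm; last by nra.
  split; last by apply/andP; split; lra.
    by rewrite rmorphB !rmorphM/= /qR; ring.
  by nra.
- have kR : k%:~R = 2 * j%:~R :> R by rewrite kj rmorphM.
  have [n /andP[n1 n2]] := int_in_unit_interval (u0 + y).
  exists (n - 4 * q%:Z * j), j, (n%:~R - y - 4 * qR * j%:~R).
  rewrite kR in k2 kQ.
  rewrite ler0_norm; last by nra.
  split; last by apply/andP; split; lra.
    by rewrite rmorphB !rmorphM/= /qR; ring.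
  by nra.
Qed.

Theorem theorem2 (R : realType) (c : R) (hc : c < 4%:R / 3%:R) :
  exists (k : nat) (v : 'I_k -> R) (a : 'I_k -> R -> R),
    [/\ forall i : 'I_k, 0 < v i,
        is_schedule v a &
        patrols a (c * (\sum_(i < k) v i) / 2%:R) 1].
Proof.
pose v (i : 'I_(4 * (13 + 3) + 1).+1) : R :=
  if (i < 4 * (13 + 3) + 1)%N then 1 else 13%:R.
have [a [aS aP]] := @unit_speed_swarm_patrols R 13 4 v isT isT (fun=> erefl).
exists _, v, a; split=> //.
  by move=> i; rewrite /v; case: ifP.
have sum_v : \sum_i v i = 78%:R.
  rewrite big_ord_recr/= {2}/v/=.
  rewrite (eq_bigr (fun=> 1)); last by move=> i _; rewrite /v/= ltn_ord.
  by rewrite sumr_const card_ord -natrD.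
(* The required length [39 * c] is below 52. *)
move=> t x; rewrite in_itv/= => /andP[x0 xL]; apply: aP.
by rewrite in_itv/= x0/=; move: xL; rewrite sum_v; lra.
Qed.
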